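(* Let $X$ be a Banach space, $\mathcal{F}$ a regular thin family and $L\subseteq\mathbb{N}$ infinite. Every spreading model $(e_n)_{n\in\mathbb{N}}$ generated by a seminormalized, subordinated and weakly null $\mathcal{F}$-subsequence $(x_s)_{s\in\mathcal{F}\upharpoonright L}$ in $X$ is unconditional.
   Context: $\mathbb{N}=\{1,2,\dots\}$. For $L\subseteq\mathbb{N}$ infinite, $L(k)$ is its $k$-th element; for a finite set $s$, $s(k)$ is its $k$-th element; $t\sqsubseteq s$ means initial segment. For a family $\mathcal{F}$ of finite subsets of $\mathbb{N}$ let $\widehat{\mathcal{F}}=\{t:\exists s\in\mathcal{F},\ t\sqsubseteq s\}$, $\mathcal{F}\upharpoonright L=\{s\in\mathcal{F}:s\subseteq L\}$ and $\widehat{\mathcal{F}}\upharpoonright L=\{t\in\widehat{\mathcal{F}}:t\subseteq L\}$. $\mathcal{F}$ is thin if no element is a proper initial segment of another. A family is regular if it is hereditary (closed under subsets), spreading (if $\{n_1<\dots<n_k\}$ is in it, $m_1<\dots<m_k$, $n_i\le m_i$ for all $i$, then $\{m_1,\dots,m_k\}$ is in it) and compact (its characteristic functions form a closed subset of $\{0,1\}^{\mathbb{N}}$). $\mathcal{F}$ is regular thin if it is thin and $\widehat{\mathcal{F}}$ is regular; regular thin families are assumed to contain a nonempty set. A tuple $(s_1,\dots,s_l)$ of nonempty finite subsets of $\mathbb{N}$ is plegma if $s_i(k)<s_j(k)$ whenever $i<j$ and $k\le\min(|s_i|,|s_j|)$, and $s_i(k)<s_j(k+1)$ for all $i,j$ and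 $k\le\min(|s_i|,|s_j|-1)$. An $\mathcal{F}$-subsequence $(x_s)_{s\in\mathcal{F}\upharpoonright L}$ in $X$ is a map $s\mapsto x_s$ from $\mathcal{F}\upharpoonright L$ to $X$. It is seminormalized if there are $0<c\le C$ with $c\le\|x_s\|\le C$ for all $s$; weakly null if for every weak neighbourhood $U$ of $0$ there is $m$ with $x_s\in U$ for all $s\in\mathcal{F}\upharpoonright L$ with $\min s\ge m$; subordinated (with respect to the weak topology) if there is a continuous map $\widehat{\varphi}:\widehat{\mathcal{F}}\upharpoonright L\to(X,w)$ with $\widehat{\varphi}(s)=x_s$ for all $s\in\mathcal{F}\upharpoonright L$, where $\widehat{\mathcal{F}}\upharpoonright L$ carries the topology inherited from $\{0,1\}^{\mathbb{N}}$ via characteristic functions. Let $(e_n)_n$ be a Hamel basis of an infinite-dimensional seminormed space $(E,\|\cdot\|_* )$. $(x_s)_{s\in\mathcal{F}\upharpoonright L}$ generates $(e_n)_n$ as a ($\mathcal{F}$-)spreading model if there is a null sequence $(\delta_n)_n$ of positive reals such that $\big|\,\|\sum_{j=1}^k a_jx_{s_j}\|-\|\sum_{j=1}^k a_je_j\|_*\big|\le\delta_l$ for all $1\le k\le l$, all plegma $k$-tuples $(s_j)_{j=1}^k$ in $\mathcal{F}\upharpoonright L$ with $s_1(1)\ge L(l)$ and all $a_1,\dots,a_k\in[-1,1]$. $(e_n)_n$ is unconditional if $\|\cdot\|_*$ is a norm on its span and there is $C>0$ with $\|\sum_{i\in F}a_ie_i\|_*\le C\|\sum_{i=1}^na_ie_i\|_*$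 for all $n$, $F\subseteq\{1,\dots,n\}$ and reals $a_1,\dots,a_n$. *)

(* Defs.v *)
From HB Require Import structures.
From mathcomp Require Import all_boot all_order all_algebra finmap.
From mathcomp Require Import all_classical all_reals all_analysis.

Set Implicit Arguments.
Unset Strict Implicit.
Unset Printing Implicit Defensive.

Import Order.TTheory GRing.Theory Num.Theory.
Import numFieldNormedType.Exports.

Local Open Scope classical_set_scope.
Local Open Scope ring_scope.

(* N = {1, 2, ...}: its subsets are the subsets of [nat] omitting 0, and
   element positions are counted from 1 (position 0 is meaningless). *)

Definition positives : set nat := [set n | (0 < n)%N].

Definition inf_elt (L : set nat) (k : nat) : nat :=
  get [set n | L n /\ count (fun i => `[< L i >]) (iota 1 n) = k].

Definition fin_elt (s : {fset nat}) (k : nat) : nat :=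
  nth 0%N (sort leq s) k.-1.

Definition initial_segment (t s : {fset nat}) : Prop :=
  (t `<=` s)%fset /\
  forall i j : nat, i \in t -> j \in s -> (j <= i)%N -> j \in t.

Definition fin_family := set {fset nat}.

Definition family_on_positives (F : fin_family) : Prop :=
  forall s, F s -> [set` s] `<=` positives.

Definition hat (F : fin_family) : fin_family :=
  [set t | exists2 s, F s & initial_segment t s].

Definition restr (F : fin_family) (L : set nat) : fin_family :=
  [set s | F s /\ [set` s] `<=` L].

(* The coordinate at 0 is constantly [false] on families of subsets of N, so
   [cantor_space], the product of copies of [bool] indexed by [nat], induces
   on them the topology of {0,1}^N. *)
Definition char_fun (s : {fset nat}) : cantor_space := fun n => n \in s.

Definition fset_space : topologicalType := initial_topology char_fun.

Definition thin (F : fin_family) : Prop :=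
  forall s t, F s -> F t -> initial_segment t s -> t = s.

Definition hereditary (F : fin_family) : Prop :=
  forall s t : {fset nat}, F s -> (t `<=` s)%fset -> F t.

Definition spreading (F : fin_family) : Prop :=
  forall s t : {fset nat}, F s -> #|` t| = #|` s| ->
    (forall k, (1 <= k <= #|` s|)%N -> (fin_elt s k <= fin_elt t k)%N) -> F t.

Definition compact_family (F : fin_family) : Prop := closed (char_fun @` F).

Definition regular (F : fin_family) : Prop :=
  [/\ hereditary F, spreading F & compact_family F].

Definition regular_thin (F : fin_family) : Prop :=
  [/\ thin F, regular (hat F) & exists2 s, F s & s <> fset0].

Definition plegma (l : nat) (s : 'I_l -> {fset nat}) : Prop :=
  [/\ forall i, s i <> fset0,
      forall (i j : 'I_l) k, (i < j)%N ->
        (1 <= k <= minn #|` s i| #|` s j|)%N ->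
        (fin_elt (s i) k < fin_elt (s j) k)%N
    & forall (i j : 'I_l) k,
        (1 <= k <= minn #|` s i| (#|` s j| - 1))%N ->
        (fin_elt (s i) k < fin_elt (s j) k.+1)%N].

Record topdual (R : realType) (X : normedModType R) := TopDual {
  functional :> {linear X -> R^o};
  functional_continuous : continuous functional }.

Definition weak (R : realType) (X : normedModType R) : topologicalType :=
  sup_topology
    (fun f : topdual X => Topological.class (initial_topology (f : X -> R^o))).

(* An F-subsequence (x_s) indexed by [restr F L] is given by a total map whose
   values outside [restr F L] are irrelevant. *)

Definition seminormalized (R : realType) (X : normedModType R)
    (F : fin_family) (L : set nat) (x : {fset nat} -> X) : Prop :=
  exists c C : R, [/\ 0 < c, c <= C &
    forall s, restr F L s -> c <= `|x s| <= C].

Definition weakly_null (R : realType) (X : normedModType R)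
    (F : fin_family) (L : set nat) (x : {fset nat} -> X) : Prop :=
  forall U : set X, nbhs (0 : weak X) U ->
    exists m : nat, forall s, restr F L s -> (m <= fin_elt s 1)%N -> U (x s).

Definition subordinated (R : realType) (X : normedModType R)
    (F : fin_family) (L : set nat) (x : {fset nat} -> X) : Prop :=
  exists phi : fset_space -> weak X,
    {within (restr (hat F) L : set fset_space), continuous phi} /\
    forall s, restr F L s -> phi s = x s.

Definition seminorm (R : realType) (E : lmodType R) (p : E -> R) : Prop :=
  [/\ forall v, 0 <= p v,
      forall u v, p (u + v) <= p u + p v
    & forall (a : R) v, p (a *: v) = `|a| * p v].

(* Sequences of vectors are indexed from 0: [e i] is e_{i+1}.
   Linear independence of the infinite sequence forces [E] to be
   infinite-dimensional. *)
Definition hamel_basis (R : realType) (E : lmodType R) (e : nat -> E) : Prop :=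
  (forall n (a : 'I_n -> R),
     \sum_(i < n) a i *: e i = 0 -> forall i, a i = 0) /\
  (forall v, exists n (a : 'I_n -> R), v = \sum_(i < n) a i *: e i).

Definition generates (R : realType) (X : normedModType R)
    (F : fin_family) (L : set nat) (x : {fset nat} -> X)
    (E : lmodType R) (p : E -> R) (e : nat -> E) : Prop :=
  exists delta : nat -> R,
    [/\ forall n, 0 < delta n,
        delta n @[n --> \oo] --> 0
      & forall (k l : nat) (s : 'I_k.+1 -> {fset nat}) (a : 'I_k.+1 -> R),
          (k.+1 <= l)%N ->
          plegma s -> (forall j, restr F L (s j)) ->
          (inf_elt L l <= fin_elt (s ord0) 1)%N ->
          (forall j, -1 <= a j <= 1) ->
          `| `|\sum_(j < k.+1) a j *: x (s j)|
             - p (\sum_(j < k.+1) a j *: e j) | <= delta l].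

Definition unconditional (R : realType) (E : lmodType R)
    (p : E -> R) (e : nat -> E) : Prop :=
  (forall n (a : 'I_n -> R), p (\sum_(i < n) a i *: e i) = 0 ->
     \sum_(i < n) a i *: e i = 0) /\
  exists2 C : R, 0 < C &
    forall n (A : {set 'I_n}) (a : 'I_n -> R),
      p (\sum_(i in A) a i *: e i) <= C * p (\sum_(i < n) a i *: e i).

(* Main.v *)
(**
  The constant is 1: deleting one coordinate from a combination does not
  increase its norm.  Let [phi] be the weakly continuous extension of [x] to the
  tree [hat F].  Weak nullness forces [f (phi fset0) = 0] for every functional
  [f], and at an inner node [t] the values [phi (b |` t)] converge weakly to
  [phi t], so by Mazur's theorem [phi t] is close in norm to a convex
  combination of the [phi (b |` t)] with [b] in a finite block; finitely many
  nodes can share the same block.  Take consecutive blocks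
  [B 0 < B 1 < B 2 < ...] of this kind.  If, for [i < n], the [k]-th element of
  [s i] lies in the block number [k * n + i], then [s] is plegma.  Hence, all
  the [s j] with [j <> i] being fixed, one descends the tree from the root, where
  the [i]-th vector is 0, choosing at each node a successor which does not
  decrease (up to a small error) the norm of the whole combination.  Compactness
  of [hat F] excludes infinite branches, so the descent stops at some [s i] in
  [F].  The norms before and after are those of the combinations without and
  with the [i]-th coordinate.
*)

Require Import Defs.
From HB Require Import structures.
From mathcomp Require Import all_boot all_order all_algebra finmap.
From mathcomp Require Import all_classical all_reals all_analysis.
From mathcomp Require Import zify lra.

Set Implicit Arguments.
Unset Strict Implicit.
Unset Printing Implicit Defensive.

Import Order.TTheory GRing.Theory Num.Theory.
Import numFieldNormedType.Exports.

Local Open Scope classical_set_scope.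
Local Open Scope ring_scope.

(** * Hahn-Banach and Mazur theorems *)

Section SublinearFunctionals.
Variables (R : realType) (V : lmodType R).
Implicit Types (p q : V -> R) (K : set (V * R)).

Definition sublinear p : Prop :=
  (forall u v, p (u + v) <= p u + p v) /\
  forall (a : R) v, 0 <= a -> p (a *: v) <= a * p v.

Lemma sublinear_ge0 p : sublinear p -> forall v, 0 <= p v + p (- v).
Proof.
move=> [pD pZ] v; apply: (le_trans _ (pD _ _)); rewrite subrr.
by have := pD 0 0; rewrite addr0; lra.
Qed.

Lemma sublinear0 p : sublinear p -> p 0 = 0.
Proof.
move=> sp; have := sublinear_ge0 sp 0; have := sp.2 0 0 (lexx _).
by rewrite scale0r mul0r oppr0; lra.
Qed.

Definition convex_cone K : Prop :=
  [/\ K (0, 0),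
      forall x y, K x -> K y -> K (x + y)
    & forall (a : R) x, 0 <= a -> K x -> K (a *: x.1, a * x.2)].

(** An infimal convolution. Under the hypotheses of the section below, a linear functional dominated
    by it is dominated by [p] and is at least [c] at [v] for every [(v, c)] in [K]: take
    [x = - v]. *)
Definition inf_conv p K (x : V) : R :=
  inf [set p (x + y.1) - y.2 | y in K].

Section InfConv.
Variables (p : V -> R) (K : set (V * R)).
Hypotheses (sp : sublinear p) (cK : convex_cone K).
Hypothesis le_p : forall y, K y -> y.2 <= p y.1.

Let E x := [set p (x + y.1) - y.2 | y in K].

Let E_lb x : lbound (E x) (- p (- x)).
Proof.
move=> _ [y Ky <-]; have := le_p Ky; have := sp.1 (x + y.1) (- x).
by rewrite addrAC subrr add0r; lra.
Qed.

Let E_neq0 x : E x !=set0.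
Proof. by case: cK => K0 _ _; exists (p (x + 0) - 0); exists (0, 0). Qed.

Lemma inf_conv_le x y : K y -> inf_conv p K x <= p (x + y.1) - y.2.
Proof.
move=> Ky; apply: ge_inf; last by exists y.
by exists (- p (- x)); exact: E_lb.
Qed.

Lemma le_inf_conv x c :
  (forall y, K y -> c <= p (x + y.1) - y.2) -> c <= inf_conv p K x.
Proof. by move=> H; apply: lb_le_inf (E_neq0 x) _ => _ [y Ky <-]; exact: H. Qed.

Lemma inf_conv_dominated x : inf_conv p K x <= p x.
Proof.
case: cK => K0 _ _; have /= := inf_conv_le x K0.
by rewrite addr0 subr0.
Qed.

Lemma sublinear_inf_conv : sublinear (inf_conv p K).
Proof.
case: cK => K0 KD KZ; split=> [u v|a v].
  rewrite -lerBlDr; apply: le_inf_conv => y Ky.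
  rewrite lerBlDr -lerBlDl; apply: le_inf_conv => z Kz.
  rewrite lerBlDl; apply: le_trans (inf_conv_le _ (KD _ _ Ky Kz)) _ => /=.
  by have := sp.1 (u + y.1) (v + z.1); rewrite addrACA; lra.
rewrite le_eqVlt => /orP[/eqP <-|a0].
  rewrite scale0r mul0r -(sublinear0 sp).
  exact: inf_conv_dominated.
rewrite -ler_pdivrMl//; apply: le_inf_conv => y Ky.
rewrite ler_pdivrMl//; apply: le_trans (inf_conv_le _ (KZ _ _ (ltW a0) Ky)) _.
rewrite /= -scalerDr mulrBr.
by have := sp.2 a (v + y.1) (ltW a0); lra.
Qed.

End InfConv.

(** Zorn's lemma for the reversed pointwise order [r]. The lower bound of a chain is its pointwise
    infimum, finite because every member is at least [- p (- x)] at [x]. *)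
Lemma minimal_sublinear p : sublinear p ->
  exists f, [/\ sublinear f, (forall x, f x <= p x) &
    forall q, sublinear q -> (forall x, q x <= f x) -> q = f].
Proof.
move=> sp.
pose T := {f : V -> R | sublinear f /\ forall x, f x <= p x}.
pose r (f g : T) := `[< forall x, sval g x <= sval f x >].
have [||||[f [sf fp]] fmin] := @Zorn T r.
- by move=> f; apply/asboolP.
- move=> f g h /asboolP gf /asboolP hg; apply/asboolP => x.
  exact: le_trans (hg x) (gf x).
- move=> [f Pf] [g Pg] /asboolP/= gf /asboolP/= fg; apply: eq_exist.
  by apply/funext => x; apply/eqP; rewrite eq_le gf fg.
- move=> A tA; have [[f0 Af0]|A0] := pselect (A !=set0); last first.
    exists (exist _ p (conj sp (fun=> lexx _))) => f Af.
    by exfalso; apply: A0; exists f.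
  pose E x := [set sval f x | f in A].
  have E_lb x : lbound (E x) (- p (- x)).
    move=> _ [f Af <-]; have [sf fp] := svalP f.
    by have := sublinear_ge0 sf x; have := fp (- x); lra.
  have E_neq0 x : E x !=set0 by exists (sval f0 x); exists f0.
  pose g x := inf (E x).
  have gle f x : A f -> g x <= sval f x.
    by move=> Af; apply: ge_inf; [exists (- p (- x))|exists f].
  have leg x c : (forall f, A f -> c <= sval f x) -> c <= g x.
    by move=> H; apply: lb_le_inf => // _ [f Af <-]; exact: H.
  have sg : sublinear g.
    split=> [u v|a v a0].
      rewrite -lerBlDr; apply: (leg) => f Af.
      rewrite lerBlDr -lerBlDl; apply: (leg) => h Ah; rewrite lerBlDl.
      (* The smaller of the comparable functions [f] and [h] serves for both [u] and [v]. *)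
      case: (tA _ _ Af Ah) => /asboolP fh.
        have := (svalP h).1.1 u v; have := fh u; have := gle _ (u + v) Ah.
        by lra.
      have := (svalP f).1.1 u v; have := fh v; have := gle _ (u + v) Af.
      by lra.
    move: a0; rewrite le_eqVlt => /orP[/eqP <-|a0].
      rewrite scale0r mul0r -(sublinear0 (svalP f0).1).
      exact: gle.
    rewrite -ler_pdivrMl//; apply: (leg) => f Af; rewrite ler_pdivrMl//.
    by apply: le_trans (gle _ _ Af) _; exact: (svalP f).1.2 (ltW a0).
  have gp x : g x <= p x.
    by apply: le_trans (gle _ _ Af0) _; exact: (svalP f0).2.
  by exists (exist _ g (conj sg gp)) => f Af; apply/asboolP => x /=; exact: gle.
exists f; split=> // q sq qf.
have qp x : q x <= p x by exact: le_trans (qf x) (fp x).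
have := fmin (exist _ q (conj sq qp)) => /(_ _)/(congr1 sval)/=.
by apply; apply/asboolP.
Qed.

(* Lowering a minimal functional [f] along the ray spanned by [y] changes
   nothing, which forces [f x + f y <= f (x + y)]. *)
Lemma dominated_linear p : sublinear p ->
  exists f : {linear V -> R^o}, forall x, f x <= p x.
Proof.
move=> /minimal_sublinear[f [sf fp fmin]].
have fD x y : f (x + y) = f x + f y.
  apply/eqP; rewrite eq_le sf.1/=.
  pose K := [set z : V * R | exists2 t, 0 <= t & z = (t *: y, t * f y)].
  have cK : convex_cone K.
    split.
    - by exists 0; rewrite ?scale0r ?mul0r.
    - move=> _ _ [s s0 ->] [t t0 ->]; exists (s + t); first exact: addr_ge0.
      by rewrite scalerDl mulrDl.
    - move=> a _ a0 [t t0 ->]; exists (a * t); first exact: mulr_ge0.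
      by rewrite /= scalerA mulrA.
  have Kf z : K z -> z.2 <= f z.1.
    move=> [t t0 ->] /=; have [<-|tN0] := eqVneq 0 t.
      by rewrite !mul0r scale0r (sublinear0 sf).
    have tp : 0 < t by rewrite lt0r eq_sym tN0.
    rewrite -ler_pdivlMl//.
    have := sf.2 t^-1 (t *: y); rewrite invr_ge0 t0 scalerA mulVf ?scale1r//.
      by apply.
    by rewrite eq_sym.
  have := fmin _ (sublinear_inf_conv sf cK Kf) (inf_conv_dominated sf cK Kf).
  move=> fE; rewrite -lerBrDr -{1}fE.
  have := @inf_conv_le _ _ sf Kf x (y, f y); apply.
  by exists 1; rewrite ?scale1r ?mul1r.
have fN x : f (- x) = - f x.
  by apply/eqP; rewrite -subr_eq0 opprK -fD addNr (sublinear0 sf).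
have fZp a x : 0 <= a -> f (a *: x) = a * f x.
  move=> a0; apply/eqP; rewrite eq_le sf.2//=.
  by have := sf.2 _ (- x) a0; rewrite scalerN !fN; lra.
have fZ a x : f (a *: x) = a * f x.
  have [a0|a0] := leP 0 a; first exact: fZp.
  by rewrite -[a]opprK scaleNr fN fZp ?mulNr// oppr_ge0 ltW.
have flin : linear (f : V -> R^o) by move=> a u v; rewrite fD fZ.
pose F : {linear V -> R^o} :=
  HB.pack (f : V -> R^o) (GRing.isLinear.Build R V R^o _ _ flin).
by exists F.
Qed.

End SublinearFunctionals.

Lemma bounded_topdual (R : realType) (X : normedModType R)
    (f : {linear X -> R^o}) :
  (forall x, f x <= `|x|) -> exists g : topdual X, forall x, g x = f x.
Proof.
move=> f1; suff cf : continuous f by exists (TopDual cf).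
apply/linear_bounded_continuous/linear_boundedP.
near=> r => x; apply: (@le_trans _ _ `|x|).
  by rewrite ler_norml f1 andbT lerNl -linearN -[leRHS]normrN f1.
by rewrite ler_peMl//; near: r; exact: nbhs_pinfty_ge.
Unshelve. all: by end_near. Qed.

(* Mazur's theorem; a convex combination of the [v b] which is almost null makes
   [u] an approximate convex combination of the [u + a *: v b], and the largest
   of their norms is thus almost [`|u|]. *)
Lemma mazur (R : realType) (X : normedModType R) (I : choiceType) (D : set I)
    (v : I -> X) (eps : R) : 0 < eps ->
  (forall (f : topdual X) d, 0 < d -> exists2 i, D i & f (v i) < d) ->
  exists2 bs : seq I, (forall b, b \in bs -> D b) &
    forall u (a : R), `|a| <= 1 ->
      exists2 b, b \in bs & `|u| <= `|u + a *: v b| + eps.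
Proof.
move=> eps0 vD.
pose ok (l : seq (R * I)) := forall z, z \in l -> 0 <= z.1 /\ D z.2.
(* The weights stay unnormalized so that such combinations form a cone; division by the total weight
   gives a convex combination of norm less than [eps]. *)
suff [l lok lt_l] : exists2 l, ok l &
    `|\sum_(z <- l) z.1 *: v z.2| < eps * \sum_(z <- l) z.1.
  exists [seq z.2 | z <- l].
    by move=> _ /mapP[z zl ->]; exact: (lok z zl).2.
  move=> u a a1; apply: contrapT => H.
  have {}H z : z \in l -> `|u + a *: v z.2| + eps <= `|u|.
    move=> zl; rewrite leNgt; apply/negP => zu; apply: H.
    by exists z.2; [exact: map_f|exact: ltW].
  have S0 : 0 < \sum_(z <- l) z.1.
    by rewrite -(pmulr_rgt0 _ eps0); exact: le_lt_trans lt_l.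
  have : (\sum_(z <- l) z.1) * `|u| <=
      \sum_(z <- l) z.1 * `|u + a *: v z.2| +
      `|a| * `|\sum_(z <- l) z.1 *: v z.2|.
    have -> : (\sum_(z <- l) z.1) * `|u| = `|\sum_(z <- l) z.1 *: u|.
      by rewrite -scaler_suml normrZ gtr0_norm.
    have -> : \sum_(z <- l) z.1 *: u = \sum_(z <- l) z.1 *: (u + a *: v z.2)
        - a *: \sum_(z <- l) z.1 *: v z.2.
      rewrite scaler_sumr -sumrB; apply: eq_bigr => z _.
      by rewrite scalerDr !scalerA [a * _]mulrC addrK.
    apply: (le_trans (ler_normB _ _)); rewrite normrZ lerD2r.
    apply: (le_trans (ler_norm_sum _ _ _)).
    rewrite !big_seq; apply: ler_sum => z zl; rewrite normrZ ger0_norm//.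
    exact: (lok z zl).1.
  apply/negP; rewrite -ltNge.
  have : \sum_(z <- l) z.1 * `|u + a *: v z.2| <=
      (\sum_(z <- l) z.1) * `|u| - (\sum_(z <- l) z.1) * eps.
    rewrite -mulrBr mulr_suml !big_seq; apply: ler_sum => z zl.
    by rewrite ler_wpM2l ?lerBrDr ?H//; exact: (lok z zl).1.
  have := normr_ge0 (\sum_(z <- l) z.1 *: v z.2).
  have := ler_wpM2r (normr_ge0 (\sum_(z <- l) z.1 *: v z.2)) a1.
  by rewrite mul1r; lra.
(* Otherwise the cone [K] lies below the norm, and the functional dominated by the infimal
   convolution is at least [eps] at every [v i] with [D i], against [vD]. *)
apply: contrapT => H.
pose K := [set y : X * R | exists2 l, ok l &
  y = (\sum_(z <- l) z.1 *: v z.2, eps * \sum_(z <- l) z.1)].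
have cK : convex_cone K.
  split.
  - by exists [::]; rewrite ?big_nil ?mulr0.
  - move=> _ _ [l okl ->] [m okm ->]; exists (l ++ m).
      by move=> z; rewrite mem_cat => /orP[/okl|/okm].
    by rewrite !big_cat mulrDr.
  - move=> a _ a0 [l okl ->]; exists [seq (a * z.1, z.2) | z <- l].
      move=> _ /mapP[z /okl[z0 Dz] ->]; split => //=.
      exact: mulr_ge0.
    rewrite !big_map /= scaler_sumr -mulr_sumr mulrCA; congr pair.
    by apply: eq_bigr => z _; rewrite scalerA.
have sn : sublinear (fun x : X => `|x|).
  by split=> [x y|a x a0]; [exact: ler_normD|rewrite normrZ ger0_norm].
have Kn y : K y -> y.2 <= `|y.1|.
  move=> [l okl ->] /=; rewrite leNgt; apply/negP => ll.
  by apply: H; exists l.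
have [F FK] := dominated_linear (sublinear_inf_conv sn cK Kn).
have [x|f fF] := @bounded_topdual _ _ F.
  exact: le_trans (FK x) (inf_conv_dominated sn cK Kn x).
have [i Di] := vD f eps eps0; apply/negP; rewrite -leNgt fF.
rewrite -lerN2 -linearN; apply: (le_trans (FK _)).
have := @inf_conv_le _ _ _ _ sn Kn (- v i) (v i, eps).
rewrite /= addNr normr0 sub0r; apply.
exists [:: (1, i)]; first by move=> z; rewrite inE => /eqP ->.
by rewrite !big_seq1 scale1r mulr1.
Qed.

(** * Regular thin families *)

(** Nodes of the tree are handled as strictly increasing lists: a successor is then an [rcons], and
    [fin_elt] becomes [nth], shifted by one. *)
Definition fset_of_seq (sigma : seq nat) : {fset nat} :=
  [fset i in sigma]%fset.

Lemma in_fset_of_seq sigma i : (i \in fset_of_seq sigma) = (i \in sigma).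
Proof. by rewrite !inE. Qed.

Lemma fset_of_seq_rcons sigma b :
  fset_of_seq (rcons sigma b) = (b |` fset_of_seq sigma)%fset.
Proof. by apply/fsetP => i; rewrite !inE mem_rcons inE. Qed.

Lemma sort_fset_of_seq sigma :
  sorted ltn sigma -> sort leq (fset_of_seq sigma) = sigma.
Proof.
move=> s; have := s; rewrite ltn_sorted_uniq_leq => /andP[us ls].
apply: (@sorted_eq _ leq leq_trans anti_leq) => //.
  exact: (sort_sorted leq_total).
rewrite perm_sort; apply: uniq_perm => [||i]; [exact: fset_uniq|by []|].
exact: in_fset_of_seq.
Qed.

Lemma card_fset_of_seq sigma :
  sorted ltn sigma -> #|` fset_of_seq sigma| = size sigma.
Proof. by move=> s; rewrite -[in RHS](sort_fset_of_seq s) size_sort. Qed.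

Lemma fin_elt_fset_of_seq sigma k : sorted ltn sigma ->
  fin_elt (fset_of_seq sigma) k = nth 0%N sigma k.-1.
Proof. by move=> s; rewrite /fin_elt sort_fset_of_seq. Qed.

Lemma sorted_sort_fset (s : {fset nat}) : sorted ltn (sort leq s).
Proof.
by rewrite ltn_sorted_uniq_leq sort_uniq fset_uniq (sort_sorted leq_total).
Qed.

Lemma fset_of_sort (s : {fset nat}) : fset_of_seq (sort leq s) = s.
Proof. by apply/fsetP => i; rewrite in_fset_of_seq mem_sort. Qed.

Lemma fset_neq0_card (s : {fset nat}) : s <> fset0 -> (0 < #|` s|)%N.
Proof. by move=> /eqP; rewrite cardfs_gt0. Qed.

Lemma sorted_rcons_ltn sigma b : sorted ltn sigma ->
  (forall i, i \in sigma -> (i < b)%N) -> sorted ltn (rcons sigma b).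
Proof.
case: sigma => //= x s xs xb; rewrite rcons_path xs /=.
by apply: xb; exact: mem_last.
Qed.

(** Convergence in a product is coordinatewise, and in the discrete factor [bool] it means eventual
    equality. *)
Lemma cvg_cantor (u : nat -> {fset nat}) (c : cantor_space) :
  (forall i, exists m, forall n, (m <= n)%N -> (i \in u n) = c i) ->
  (char_fun (u n) @[n --> \oo]) --> c.
Proof.
move=> uc; apply/cvg_sup => i; apply/cvg_image.
  by apply/seteqP; split=> // b _; exists (fun=> b).
move=> A cA; have [m mP] := uc i; exists ((fun f : nat -> bool => f i) @^-1` A).
  exists m => // n mn /=; rewrite /char_fun mP//.
  exact: nbhs_singleton.
by apply/seteqP; split=> [_ [f Af <-]//|b Ab]; exists (fun=> b).
Qed.

Section RegularThin.
Variable F : fin_family.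
Hypothesis F_rt : regular_thin F.

Lemma hat_fset0 : hat F fset0.
Proof.
case: F_rt => _ _ [s Fs _]; by exists s.
Qed.

Lemma sub_hat s : F s -> hat F s.
Proof. by move=> Fs; exists s => //; split. Qed.

Lemma not_F_fset0 : ~ F fset0.
Proof.
by case: F_rt => thinF _ [s Fs s0] F0; apply/s0/esym/thinF.
Qed.

Lemma hat_spreading sigma tau : sorted ltn sigma -> sorted ltn tau ->
  size tau = size sigma ->
  (forall k, (k < size sigma)%N -> (nth 0 sigma k <= nth 0 tau k)%N) ->
  hat F (fset_of_seq sigma) -> hat F (fset_of_seq tau).
Proof.
move=> ss st e le hs; case: F_rt => _ [_ spr _] _.
apply: spr hs _ _; first by rewrite !card_fset_of_seq.
move=> k; rewrite card_fset_of_seq// !fin_elt_fset_of_seq//.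
by case: k => // k /andP[_ k_lt]; exact: le.
Qed.

(** The node is a proper initial segment of some [s] in [F]. Adding an element [b0] of the rest of
    [s] stays in the tree by heredity, and spreading replaces [b0] by any larger [b]. *)
Lemma hat_extend sigma : sorted ltn sigma -> hat F (fset_of_seq sigma) ->
  ~ F (fset_of_seq sigma) ->
  exists m, forall b, (m <= b)%N -> hat F (fset_of_seq (rcons sigma b)).
Proof.
move=> ss [s Fs [ts init]] nF.
have [b0 b0s b0t] : exists2 b0, b0 \in s & b0 \notin fset_of_seq sigma.
  apply: contrapT => H; apply: nF; suff -> : fset_of_seq sigma = s by [].
  apply/eqP; rewrite eqEfsubset ts; apply/fsubsetP => i si.
  by apply: contrapT => /negP it; apply: H; exists i.
have b0_gt i : i \in sigma -> (i < b0)%N.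
  move=> it; rewrite ltnNge; apply/negP => b0i; move/negP: b0t; apply.
  by apply: init b0i; rewrite ?in_fset_of_seq.
exists b0 => b b0b.
apply: (@hat_spreading (rcons sigma b0)); rewrite ?size_rcons//.
- exact: sorted_rcons_ltn.
- by apply: sorted_rcons_ltn => // i /b0_gt ib; exact: leq_trans ib b0b.
- by move=> k _; rewrite !nth_rcons; case: ifP => // _; case: ifP.
- case: F_rt => _ [her _ _] _; apply: her (sub_hat Fs) _.
  by rewrite fset_of_seq_rcons fsubUset ts fsub1set b0s.
Qed.

(** Along an infinite branch the characteristic functions converge to that of the range of [g];
    compactness would put this infinite set into a family of finite sets. *)
Lemma hat_no_branch (g : nat -> nat) : (forall k, (g k < g k.+1)%N) ->
  exists k, ~ hat F (fset_of_seq (mkseq g k)).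
Proof.
move=> gS; apply: contrapT => H.
have ginj : {homo g : x y / (x < y)%N} by exact: homo_ltn ltn_trans gS.
have gk k : (k <= g k)%N.
  by elim: k => // k IH; exact: leq_ltn_trans IH (gS k).
have hg k : hat F (fset_of_seq (mkseq g k)).
  by apply: contrapT => nh; apply: H; exists k.
case: F_rt => _ [_ _ cpt] _.
pose chi : cantor_space := fun i => `[< exists k, g k = i >].
have : (char_fun @` hat F) chi.
  apply: (closed_cvg (F := \oo)
    (u_ := fun n => char_fun (fset_of_seq (mkseq g n))) _ cpt).
    by near=> n; exists (fset_of_seq (mkseq g n)).
  apply: cvg_cantor => i; exists i.+1 => n ni; rewrite in_fset_of_seq.
  apply/mapP/asboolP => [[k _ ->]|[k ki]]; first by exists k.
  exists k => //; rewrite mem_iota /=; apply: leq_ltn_trans (gk k) _.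
  by rewrite ki.
case=> s _ sE.
pose m := (\max_(i <- s) i)%N.
have : g m.+1 \in s by rewrite -[_ \in s]/(char_fun s _) sE; apply/asboolP; exists m.+1.
move=> gs; have := @leq_bigmax_seq _ _ xpredT id _ gs isT.
by rewrite -/m leqNgt => /negP; apply; exact: leq_trans (gk m.+1).
Unshelve. all: by end_near. Qed.

End RegularThin.

(** * Blocks with plegma selections *)

Section Blocks.
Variables (R : realType) (X : normedModType R).
Variables (F : fin_family) (L : set nat) (g : {fset nat} -> X).
Hypotheses (F_rt : regular_thin F) (L_infinite : infinite_set L).
(** Weak continuity along one-element extensions. The map [g] stays abstract because it is
    instantiated twice: by the zero map and by a corrected continuous extension of the
    subsequence. *)
Hypothesis g_cvg : forall sigma, sorted ltn sigma ->
  restr (hat F) L (fset_of_seq sigma) ->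
  forall (f : topdual X) d, 0 < d -> exists m, forall b, L b -> (m <= b)%N ->
    hat F (fset_of_seq (rcons sigma b)) ->
    `|f (g (fset_of_seq (rcons sigma b))) - f (g (fset_of_seq sigma))| < d.

(** The bound [M] leaves finitely many nodes, so that one block can serve them all; a node outside
    [F] has successors. *)
Definition inner_node (M : nat) (sigma : seq nat) : Prop :=
  [/\ sorted ltn sigma, forall i, i \in sigma -> (i <= M)%N,
      restr (hat F) L (fset_of_seq sigma) & ~ F (fset_of_seq sigma)].

(* The second clause is the only trace of the convex combination
   [g sigma ~ \sum_(b in B) w b *: g (rcons sigma b)]. *)
Definition averaging (eps : R) (B : seq nat) (sigma : seq nat) : Prop :=
  (forall b, b \in B -> hat F (fset_of_seq (rcons sigma b))) /\
  forall u (a : R), `|a| <= 1 -> exists2 b, b \in B &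
    `|u + a *: g (fset_of_seq sigma)| <=
    `|u + a *: g (fset_of_seq (rcons sigma b))| + eps.

Lemma L_unbounded m : exists2 b, L b & (m <= b)%N.
Proof.
apply: contrapT => H; apply: L_infinite.
apply: (@sub_finite_set _ _ `I_m); last exact: finite_II.
by move=> b Lb /=; rewrite ltnNge; apply/negP => mb; apply: H; exists b.
Qed.

(** Mazur's theorem for the differences between [g] at the successors and [g] at [sigma], on which
    every functional takes arbitrarily small values. *)
Lemma averaging_node eps M m sigma : 0 < eps -> inner_node M sigma ->
  (forall b, (m <= b)%N -> hat F (fset_of_seq (rcons sigma b))) ->
  exists2 B, (forall b, b \in B -> L b /\ (m <= b)%N) & averaging eps B sigma.
Proof.
move=> eps0 [ss _ Ts nF] hm.
have [f d d0|B BD Bu] := @mazur _ _ _ [set b | L b /\ (m <= b)%N]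
    (fun b => g (fset_of_seq (rcons sigma b)) - g (fset_of_seq sigma)) _ eps0.
  have [m' m'P] := g_cvg ss Ts f d0.
  have [b Lb mb] := L_unbounded (maxn m m'); exists b.
    by split=> //; apply: leq_trans mb; exact: leq_maxl.
  rewrite linearB; apply: le_lt_trans (ler_norm _) (m'P b Lb _ _).
    by apply: leq_trans mb; exact: leq_maxr.
  by apply: hm; apply: leq_trans mb; exact: leq_maxl.
exists B => //; split=> [b /BD[_]|u a a1]; first exact: hm.
have [b bB bP] := Bu (u + a *: g (fset_of_seq sigma)) a a1; exists b => //.
by apply: (le_trans bP); rewrite -addrA -scalerDr /= addrCA subrr addr0.
Qed.

Lemma averaging_block eps M : 0 < eps ->
  exists B, [/\ B != [::], forall b, b \in B -> L b /\ (M < b)%N &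
    forall sigma, inner_node M sigma -> averaging eps B sigma].
Proof.
move=> eps0.
pose nodes := [seq sort leq (s : {fset nat}) |
  s <- fpowerset (fset_of_seq (iota 0 M.+1))].
have nodesP sigma : inner_node M sigma -> sigma \in nodes.
  move=> [ss sM _ _]; apply/mapP; exists (fset_of_seq sigma).
    rewrite fpowersetE; apply/fsubsetP => i.
    by rewrite !in_fset_of_seq mem_iota => /sM.
  by rewrite sort_fset_of_seq.
(* A common threshold comes before the blocks: when the blocks of all nodes are concatenated, each
   element must extend every node. *)
have [m mP] : exists m, forall sigma, sigma \in nodes -> inner_node M sigma ->
    forall b, (m <= b)%N -> hat F (fset_of_seq (rcons sigma b)).
  elim: nodes {nodesP} => [|sigma l [m mP]]; first by exists 0%N.
  have [n_sigma|] := pselect (inner_node M sigma); last first.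
    move=> ns; exists m => tau; rewrite inE => /orP[/eqP ->//|]; exact: mP.
  have [ss _ [hs _] nF] := n_sigma.
  have [m' m'P] := hat_extend F_rt ss hs nF; exists (maxn m m') => tau.
  rewrite inE => /orP[/eqP -> _ b|tl nt b]; rewrite geq_max => /andP[mb m'b].
    exact: m'P.
  exact: mP.
pose m' := maxn m M.+1.
have [B BD BP] : exists2 B, (forall b, b \in B -> L b /\ (m' <= b)%N) &
    forall sigma, sigma \in nodes -> inner_node M sigma -> averaging eps B sigma.
  elim: nodes mP {nodesP} => [|sigma l IH] mP; first by exists [::].
  have [B BD BP] := IH (fun tau tl => mP tau (mem_behead (s := sigma :: l) tl)).
  have [n_sigma|ns] := pselect (inner_node M sigma); last first.
    by exists B => // tau; rewrite inE => /orP[/eqP ->//|]; exact: BP.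
  have [b|C CD [Ch Cu]] := averaging_node (m := m') eps0 n_sigma.
    by rewrite geq_max => /andP[mb _]; apply: mP; rewrite ?mem_head.
  have BCD b : b \in B ++ C -> L b /\ (m' <= b)%N.
    by rewrite mem_cat => /orP[/BD|/CD].
  exists (B ++ C) => // tau tl nt; split=> [b /BCD[_]|u a a1].
    by rewrite geq_max => /andP[mb _]; exact: (mP _ tl nt).
  move: tl nt; rewrite inE => /orP[/eqP ->|tl] nt.
    have [b bC bP] := Cu u a a1; exists b => //.
    by rewrite mem_cat bC orbT.
  have [_ /(_ u a a1)[b bB bP]] := BP _ tl nt; exists b => //.
  by rewrite mem_cat bB.
(* The extra element makes the block visibly nonempty; being beyond the threshold, it does no
   harm. *)
have [b0 Lb0 mb0] := L_unbounded m'; exists (b0 :: B).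
have BD' b : b \in b0 :: B -> L b /\ (m' <= b)%N.
  by rewrite inE => /orP[/eqP ->|/BD].
split=> // [b /BD'[Lb]|sigma ns].
  by rewrite geq_max => /andP[_].
have [_ Bu] := BP _ (nodesP _ ns) ns; split=> [b /BD'[_]|u a a1].
  by rewrite geq_max => /andP[mb _]; exact: (mP _ (nodesP _ ns) ns).
by have [b bB bP] := Bu u a a1; exists b; rewrite // inE bB orbT.
Qed.

Lemma averaging_blocks eps M0 : 0 < eps ->
  exists (B : nat -> seq nat) (top : nat -> nat), [/\ top 0%N = M0,
    forall m b, b \in B m -> [/\ L b, (top m < b)%N & (b <= top m.+1)%N],
    forall m, top m.+1 \in B m &
    forall m sigma, inner_node (top m) sigma ->
      averaging (eps / 2 ^+ m.+1) (B m) sigma].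
Proof.
move=> eps0.
have [mM|blk blkP] := @choice _ _ (fun (mM : nat * nat) (B : seq nat) =>
    [/\ B != [::], forall b, b \in B -> L b /\ (mM.2 < b)%N &
      forall sigma, inner_node mM.2 sigma ->
        averaging (eps / 2 ^+ mM.1.+1) B sigma]).
  by apply: averaging_block; rewrite divr_gt0// exprn_gt0.
(* Block [m] is chosen beyond [top m], and its maximum is the next bound. The errors
   [eps / 2 ^+ m.+1] have sum at most [eps]. *)
pose top := fix top m := if m is m'.+1 then
  (\max_(b <- blk (m', top m')) b)%N else M0.
exists (fun m => blk (m, top m)), top; split=> //.
- move=> m b bB; have [_ /(_ b bB)[Lb Mb] _] := blkP (m, top m); split=> //=.
  exact: (@leq_bigmax_seq _ _ xpredT id).
- move=> m; have [B0 _ _] := blkP (m, top m).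
  rewrite [top m.+1]/=; move: (blk _) B0 => [//|b s] _.
  elim: s b => [|c s IH] b; first by rewrite big_seq1 mem_head.
  rewrite big_cons; case: leqP => _; last by rewrite mem_head.
  by rewrite inE IH orbT.
- by move=> m; case: (blkP (m, top m)).
Qed.

(** * Descent of the tree through consecutive blocks *)

Section Paths.
Variables (eps : R) (B : nat -> seq nat) (top : nat -> nat).
Hypothesis eps_gt0 : 0 < eps.
Hypothesis BP :
  forall m b, b \in B m -> [/\ L b, (top m < b)%N & (b <= top m.+1)%N].
Hypothesis topB : forall m, top m.+1 \in B m.
Hypothesis B_averaging : forall m sigma, inner_node (top m) sigma ->
  averaging (eps / 2 ^+ m.+1) (B m) sigma.

Lemma top_ltn : {homo top : m n / (m < n)%N}.
Proof.
apply: homo_ltn ltn_trans _ => m.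
by have [] := BP (topB m).
Qed.

Lemma top_leq : {homo top : m n / (m <= n)%N}.
Proof.
move=> m n; rewrite leq_eqVlt => /orP[/eqP ->//|mn].
by rewrite ltnW// top_ltn.
Qed.

Lemma blocks_ltn m n b c :
  (m < n)%N -> b \in B m -> c \in B n -> (b < c)%N.
Proof.
move=> mn /BP[_ _ bm] /BP[_ nc _].
exact: leq_ltn_trans (leq_trans bm (top_leq mn)) nc.
Qed.

Lemma path_in_blocks N i u (a : R) : (i < N)%N -> `|a| <= 1 ->
  exists s, [/\ restr F L s,
    forall k, (k < #|` s|)%N -> fin_elt s k.+1 \in B (k * N + i)%N &
    `|u + a *: g fset0| <= `|u + a *: g s| + eps].
Proof.
move=> iN a1; apply: contrapT => H.
(* If the descent never meets [F], it reaches every length [k], with total loss at most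
   [eps * (1 - 1 / 2 ^+ k)]. *)
suff node k : exists sigma, [/\ size sigma = k, sorted ltn sigma,
    restr (hat F) L (fset_of_seq sigma),
    forall j, (j < k)%N -> nth 0%N sigma j \in B (j * N + i)%N &
    `|u + a *: g fset0| <=
    `|u + a *: g (fset_of_seq sigma)| + eps * (1 - 1 / 2 ^+ k)].
  (* The nodes of different lengths need not be comparable. The upper ends of the blocks dominate
     them all, and by spreading these ends form an infinite branch. *)
  have [l|k] := hat_no_branch F_rt (g := fun k => top (k * N + i).+1)
    _.
    by apply: top_ltn; rewrite mulSn; lia.
  apply; have [sigma [sk ss [hs _] sB _]] := node k.
  apply: (hat_spreading F_rt ss) hs; rewrite ?size_mkseq//.
    apply/(sortedP 0%N) => j; rewrite size_mkseq => jk.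
    by rewrite !nth_mkseq ?(ltnW jk)//=; apply: top_ltn; rewrite mulSn; lia.
  move=> j; rewrite sk => jk; rewrite nth_mkseq//.
  by have [] := BP (sB _ jk).
elim: k => [|k [sigma [sk ss Ts sB le_s]]].
  exists [::]; split=> //; last first.
    rewrite expr0 divr1 subrr mulr0 addr0.
    by suff -> : fset_of_seq [::] = fset0 by []; apply/fsetP => j; rewrite !inE.
  suff -> : fset_of_seq [::] = fset0 by split; [exact: hat_fset0|move=> j].
  by apply/fsetP => j; rewrite !inE.
have nF : ~ F (fset_of_seq sigma).
  move=> Fs; apply: H; exists (fset_of_seq sigma); split.
  - by split=> //; case: Ts.
  - move=> j; rewrite card_fset_of_seq// fin_elt_fset_of_seq// sk.
    exact: sB.
  - by apply: (le_trans le_s); rewrite lerD2l ler_piMr ?(ltW eps_gt0)//.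
have s_top j : j \in sigma -> (j <= top (k * N + i))%N.
  move=> /(nthP 0%N)[l]; rewrite sk => lk <-.
  have [_ _ /leq_trans] := BP (sB _ lk); apply; apply: top_leq.
  have : (l * N + N <= k * N)%N by rewrite -mulSnr leq_mul2r lk orbT.
  by lia.
have [|hB uB] := B_averaging (m := (k * N + i)%N) (sigma := sigma) _.
  by split.
have [b bB ub] := uB u a a1; have [Lb tb _] := BP bB.
exists (rcons sigma b); split.
- by rewrite size_rcons sk.
- by apply: sorted_rcons_ltn => // j /s_top jt; exact: leq_ltn_trans jt tb.
- split; first exact: hB.
  case: Ts => _ Ls j /=; rewrite fset_of_seq_rcons !inE => /orP[/eqP ->//|js].
  by apply: Ls; rewrite /= in_fset_of_seq.
- move=> j; rewrite ltnS leq_eqVlt nth_rcons sk => /orP[/eqP ->|jk].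
    by rewrite ltnn eqxx.
  by rewrite jk; exact: sB.
(* As [N] is positive, the block used at depth [k] has number at least [k]. *)
have : eps / 2 ^+ (k * N + i).+1 <= eps / 2 ^+ k.+1.
  rewrite ler_pM2l// lef_pV2 ?posrE ?exprn_gt0// ler_eXn2l ?ltr1n//.
  rewrite ltnS; case: N iN {H sB s_top hB uB bB ub tb Lb} => // N _.
  by rewrite mulnS; lia.
move: le_s ub; rewrite !exprS !div1r invfM; lra.
Qed.

(** Block numbers [k * N + i] are ordered lexicographically by [(k, i)], which is what the two
    plegma inequalities ask for. *)
Lemma plegma_in_blocks N (s : 'I_N -> {fset nat}) : (forall i, s i <> fset0) ->
  (forall i k, (k < #|` s i|)%N -> fin_elt (s i) k.+1 \in B (k * N + i)%N) ->
  plegma s.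
Proof.
move=> s0 sB; split=> // i j [//|k].
  move=> ij /andP[_]; rewrite leq_min => /andP[ki kj].
  by apply: blocks_ltn (sB _ _ ki) (sB _ _ kj); rewrite ltn_add2l.
move=> /andP[_]; rewrite leq_min ltn_subRL add1n => /andP[ki kj].
apply: blocks_ltn (sB _ _ ki) (sB _ _ kj).
by rewrite mulSn [(N + _)%N]addnC -addnA ltn_add2l ltn_addr.
Qed.

End Paths.

End Blocks.

(** * Subordinated weakly null subsequences and their spreading models *)

Lemma nbhs_weak (R : realType) (X : normedModType R) (f : topdual X) (v : X)
    (d : R) : 0 < d -> nbhs (v : weak X) [set w : X | `|f w - f v| < d].
Proof.
move=> d0.
have fv_nbhs : nbhs (f v : R^o) [set y : R^o | `|y - f v| < d].
  apply: filterS (@nbhsx_ballx _ R^o (f v) _ d0) => y.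
  by rewrite -ball_normE /= distrC.
apply: ((cvg_sup (fun f : topdual X =>
    Topological.class (initial_topology (f : X -> R^o)))
  (F := nbhs (v : weak X)) v _).1 (fun _ => id) f).
exact: (@initial_continuous X R^o f v _ fv_nbhs).
Qed.

Lemma weakly_null_functional (R : realType) (X : normedModType R)
    (F : fin_family) (L : set nat) (x : {fset nat} -> X) (f : topdual X)
    (d : R) : weakly_null F L x -> 0 < d ->
  exists m, forall s, restr F L s -> (m <= fin_elt s 1)%N -> `|f (x s)| < d.
Proof.
move=> wx d0; have [m mP] := wx _ (nbhs_weak f 0 d0); exists m => s Fs ms.
by have := mP s Fs ms; rewrite /= linear0 subr0.
Qed.

Lemma cvg_fset_space (u : nat -> {fset nat}) (t : {fset nat}) :
  (forall i, exists m, forall n, (m <= n)%N -> (i \in u n) = (i \in t)) ->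
  ((u n : fset_space) @[n --> \oo]) --> (t : fset_space).
Proof.
move=> /(cvg_cantor (c := char_fun t)) ut A [_ [[C oC <-] Ct CA]].
have /ut : nbhs (char_fun t : cantor_space) C.
  exact: (@open_nbhs_nbhs cantor_space (char_fun t) C (conj oC Ct)).
by move=> [m _ mP]; exists m => // n mn; apply: CA; exact: mP.
Qed.

Lemma within_continuous_functional (R : realType) (X : normedModType R)
    (A : set fset_space) (phi : fset_space -> weak X) (u : nat -> {fset nat})
    (t : {fset nat}) (f : topdual X) (d : R) :
  {within A, continuous phi} -> (forall n, A (u n)) -> A t ->
  (forall i, exists m, forall n, (m <= n)%N -> (i \in u n) = (i \in t)) ->
  0 < d ->
  exists m, forall n, (m <= n)%N -> `|f (phi (u n) : X) - f (phi t : X)| < d.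
Proof.
move=> /subspace_continuousP cphi Au At ut d0.
have /cvg_fset_space utc := ut.
have /= := cphi t At _ (nbhs_weak f (phi t) d0); rewrite nbhs_filterE /within /=.
move=> /utc; rewrite nbhs_filterE => -[m _ mP]; exists m => n mn.
exact: (mP n mn (Au n)).
Qed.

Section SubordinatedWeaklyNull.
Variables (R : realType) (X : normedModType R).
Variables (F : fin_family) (L : set nat) (x : {fset nat} -> X).
Hypotheses (F_rt : regular_thin F) (L_infinite : infinite_set L).
Hypotheses (x_sub : subordinated F L x) (x_null : weakly_null F L x).

Lemma restr_neq0 s : restr F L s -> s <> fset0.
Proof. by move=> [Fs _] s0; apply: (not_F_fset0 F_rt); rewrite -s0. Qed.

(** The descent is run for the zero map, where the norm estimate is void and only its termination in
    [F] beyond [top 0 = m] matters. *)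
Lemma restr_unbounded m :
  exists2 s, restr F L s & forall i, i \in s -> (m <= i)%N.
Proof.
have norm0_le1 : `|0 : R| <= 1 by rewrite normr0.
have [sigma _ _ f d d0|B [top [top0 BP topB Bav]]] :=
  @averaging_blocks R X F L (fun=> 0) F_rt L_infinite _ 1 m ltr01.
  by exists 0%N => b *; rewrite subrr normr0.
have [s [rs sB _]] :=
  path_in_blocks F_rt ltr01 BP topB Bav 0 (ltnSn 0) norm0_le1.
exists s => // i; rewrite -(mem_sort leq) => /(nthP 0%N)[k].
rewrite size_sort => ks <-; have [_ + _] := BP _ _ (sB k ks).
rewrite -{1}top0; apply: leq_trans; apply: leqW.
exact: (top_leq BP topB).
Qed.

Lemma plegma_suppression n (a : 'I_n.+1 -> R) (i : 'I_n.+1) M0 eps :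
  0 < eps -> (forall j, `|a j| <= 1) ->
  exists s : 'I_n.+1 -> {fset nat}, [/\ plegma s, forall j, restr F L (s j),
    (M0 <= fin_elt (s ord0) 1)%N &
    `|\sum_j (if j == i then 0 else a j) *: x (s j)| <=
    `|\sum_j a j *: x (s j)| + eps].
Proof.
move=> eps0 a1; have [phi [cphi phix]] := x_sub.
pose T := restr (hat F) L.
have T0 : T fset0 by split; [exact: hat_fset0|move=> j].
(* Members of [restr F L] with minima tending to infinity converge to [fset0]; along them [f] of [x]
   tends to [f (phi fset0)] by continuity and to 0 by weak nullness. *)
have phi0 (f : topdual X) : f (phi fset0 : X) = 0.
  apply/eqP; rewrite -normr_le0; apply/ler_addgt0Pr => d d0; rewrite add0r.
  have [u uP] := @choice _ _ (fun m s => restr F L s /\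
    forall j, j \in s -> (m <= j)%N) (fun m => let: ex_intro2 s p q :=
      restr_unbounded m in ex_intro _ s (conj p q)).
  have Tu m : T (u m).
    by have [[Fu Lu] _] := uP m; split=> //; exact: sub_hat.
  have d2 : 0 < d / 2 by rewrite divr_gt0.
  have [|m mP] := within_continuous_functional f cphi Tu T0 _ d2.
    move=> j; exists j.+1 => k jk; rewrite inE; apply/negP => /(uP k).2.
    by rewrite leqNgt jk.
  have [m' m'P] := weakly_null_functional f x_null d2.
  have [ru uM] := uP (maxn m m').
  have := mP _ (leq_maxl m m'); rewrite phix//.
  have : `|f (x (u (maxn m m')))| < d / 2.
    apply: m'P => //; apply: leq_trans (leq_maxr m m') (uM _ _).
    rewrite -(mem_sort leq); apply: mem_nth; rewrite size_sort.
    exact/fset_neq0_card/restr_neq0.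
  have := ler_distD (f (x (u (maxn m m')))) 0 (f (phi fset0)).
  by rewrite !sub0r !normrN; lra.
(* Without Hahn-Banach separation, [phi fset0 = 0] is only known after applying
   functionals; [g] corrects [phi] at the root. *)
pose g s : X := if s == fset0 then 0 else phi s.
have gx s : restr F L s -> g s = x s.
  by move=> rs; rewrite /g; case: eqP => [/(restr_neq0 rs)//|_]; exact: phix.
have fg (f : topdual X) s : f (g s) = f (phi s : X).
  by rewrite /g; case: eqP => // ->; rewrite phi0 linear0.
have g_cvg sigma : sorted ltn sigma -> T (fset_of_seq sigma) ->
    forall (f : topdual X) d, 0 < d -> exists m, forall b, L b -> (m <= b)%N ->
    hat F (fset_of_seq (rcons sigma b)) ->
    `|f (g (fset_of_seq (rcons sigma b))) - f (g (fset_of_seq sigma))| < d.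
  move=> ss Ts f d d0.
  (* The default value [sigma] keeps the sequence inside the domain of continuity and does not
     affect its limit. *)
  pose u b := if `[< T (fset_of_seq (rcons sigma b)) >]
    then fset_of_seq (rcons sigma b) else fset_of_seq sigma.
  have Tu b : T (u b) by rewrite /u; case: asboolP.
  have [|m mP] := within_continuous_functional f cphi Tu Ts _ d0.
    move=> j; exists j.+1 => b jb; rewrite /u; case: ifP => // _.
    by rewrite !in_fset_of_seq mem_rcons inE; case: ltngtP jb.
  exists m => b Lb mb hb; have := mP b mb; rewrite /u !fg asboolT//.
  split=> // j /=; rewrite in_fset_of_seq mem_rcons inE => /orP[/eqP ->//|js].
  by apply: Ts.2; rewrite /= in_fset_of_seq.
have [B [top [top0 BP topB Bav]]] :=
  averaging_blocks F_rt L_infinite g_cvg M0 eps0.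
have path := path_in_blocks F_rt eps0 BP topB Bav.
have norm0_le1 : `|0 : R| <= 1 by rewrite normr0.
(* For [j != i] only the position in the blocks is kept, hence the dummy vector and coefficient 0;
   the norm estimate is used for [i] alone, once the other sets are fixed in [u]. *)
have [s0 s0P] := @choice _ _ (fun (j : 'I_n.+1) s => restr F L s /\
    forall k, (k < #|` s|)%N -> fin_elt s k.+1 \in B (k * n.+1 + j)%N)
  (fun j => let: ex_intro s (And3 p q _) :=
    path _ _ 0 0 (ltn_ord j) norm0_le1 in
    ex_intro _ s (conj p q)).
pose u := \sum_(j | j != i) a j *: x (s0 j).
have [t [rt tB ut]] := path _ _ u (a i) (ltn_ord i) (a1 i).
pose s j := if j == i then t else s0 j.
have rs j : restr F L (s j) by rewrite /s; case: ifP => // _; exact: (s0P j).1.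
have sB j k : (k < #|` s j|)%N -> fin_elt (s j) k.+1 \in B (k * n.+1 + j)%N.
  by rewrite /s; case: eqP => [->|_]; [exact: tB|exact: (s0P j).2].
have su : \sum_(j | j != i) a j *: x (s j) = u.
  by apply: eq_bigr => j /negbTE ji; rewrite /s ji.
exists s; split=> //.
- apply: (plegma_in_blocks BP topB) => // j.
  exact: restr_neq0.
- have [_ + _] := BP _ _ (sB ord0 0%N (fset_neq0_card (restr_neq0 (rs ord0)))).
  by rewrite -{1}top0; move=> /ltnW; apply: leq_trans; exact: (top_leq BP topB).
rewrite (bigD1 i)//= eqxx scale0r add0r [in leRHS](bigD1 i)//= su.
have -> : \sum_(j | j != i) (if j == i then 0 else a j) *: x (s j) = u.
  by rewrite -su; apply: eq_bigr => j /negbTE ->.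
by rewrite {1}/s eqxx addrC -(gx _ rt); move: ut; rewrite {1}/g eqxx scaler0 addr0.
Qed.

End SubordinatedWeaklyNull.

(** * Suppression of coordinates in the spreading model *)

Section SpreadingModel.
Variables (R : realType) (X : normedModType R).
Variables (F : fin_family) (L : set nat) (x : {fset nat} -> X).
Variables (E : lmodType R) (p : E -> R) (e : nat -> E).
Hypotheses (F_rt : regular_thin F) (L_infinite : infinite_set L).
Hypotheses (x_seminormalized : seminormalized F L x).
Hypotheses (x_sub : subordinated F L x) (x_null : weakly_null F L x).
Hypotheses (p_seminorm : seminorm p) (x_generates : generates F L x p e).

Lemma spreading_approx n eps : 0 < eps -> exists M0,
  forall (s : 'I_n.+1 -> {fset nat}) (a : 'I_n.+1 -> R),
    plegma s -> (forall j, restr F L (s j)) -> (M0 <= fin_elt (s ord0) 1)%N ->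
    (forall j, `|a j| <= 1) ->
    `| `|\sum_j a j *: x (s j)| - p (\sum_(j < n.+1) a j *: e j) | <= eps.
Proof.
move=> eps0; have [delta [d0 dcvg dP]] := x_generates.
have [m _ mP] := (cvgrPdist_lt _ _).1 dcvg _ eps0.
(* The index must be at least [m] to make [delta] small, and at least the length [n.+1] of the
   tuple. *)
exists (inf_elt L (maxn m n.+1)) => s a ps rs ls a1.
apply: (le_trans (dP n _ s a (leq_maxr m n.+1) ps rs ls _)).
  by move=> j; rewrite -ler_norml.
by have := mP _ (leq_maxl m n.+1); rewrite /= sub0r normrN gtr0_norm// => /ltW.
Qed.

Lemma spreading_model_suppress1 n (a : 'I_n.+1 -> R) i :
  (forall j, `|a j| <= 1) ->
  p (\sum_(j < n.+1) (if j == i then 0 else a j) *: e j) <=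
  p (\sum_(j < n.+1) a j *: e j).
Proof.
move=> a1; apply/ler_addgt0Pr => d d0.
(* One third for the descent and one for each of the two approximations, both taken at the same
   plegma tuple. *)
have d3 : 0 < d / 3 by rewrite divr_gt0.
have [M0 M0P] := spreading_approx n d3.
have [s [ps rs Ms sn]] :=
  plegma_suppression F_rt L_infinite x_sub x_null i M0 d3 a1.
have := M0P s a ps rs Ms a1.
have := M0P s (fun j => if j == i then 0 else a j) ps rs Ms.
rewrite !ler_distl => /(_ _)/andP[|h1 h2 /andP[h3 h4]]; last by lra.
by move=> j; case: ifP => _; rewrite ?normr0 ?a1.
Qed.

(** The coordinates outside [A] are deleted one at a time, after a rescaling that brings the
    coefficients into [[-1, 1]]. *)
Lemma spreading_model_suppress n (A : {set 'I_n}) (a : 'I_n -> R) :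
  p (\sum_(i in A) a i *: e i) <= p (\sum_(i < n) a i *: e i).
Proof.
case: n A a => [|n] A a.
  by rewrite !big1// => -[].
have suppress_seq (b : 'I_n.+1 -> R) (r : seq 'I_n.+1) :
    (forall j, `|b j| <= 1) ->
    p (\sum_(j < n.+1) (if j \in r then 0 else b j) *: e j) <=
    p (\sum_(j < n.+1) b j *: e j).
  move=> b1; elim: r => [|i r IH]; first by under eq_bigr do rewrite in_nil.
  apply: le_trans IH; apply: le_trans (spreading_model_suppress1 i _); last first.
    by move=> j; case: ifP => _; rewrite ?normr0.
  rewrite le_eqVlt; apply/orP; left; apply/eqP; congr p.
  by apply: eq_bigr => j _; rewrite inE; case: eqP.
have [_ _ pZ] := p_seminorm.
(* The summand 1 keeps [M] positive when all coefficients vanish. *)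
pose M := 1 + \sum_j `|a j|.
have M0 : 0 < M by rewrite ltr_pwDl// sumr_ge0.
have aM j : `|M^-1 * a j| <= 1.
  rewrite normrM normfV (gtr0_norm M0) ler_pdivrMl// mulr1 /M (bigD1 j)//=.
  by rewrite addrCA lerDl addr_ge0// sumr_ge0.
have := suppress_seq _ (enum (~: A)) aM.
under eq_bigr => j _ do rewrite mem_enum inE.
have -> : \sum_(j < n.+1) (if j \notin A then 0 else M^-1 * a j) *: e j =
    M^-1 *: \sum_(i in A) a i *: e i.
  rewrite scaler_sumr [RHS]big_mkcond; apply: eq_bigr => j _.
  by case: (j \in A); rewrite ?scale0r ?scalerA.
have -> : \sum_(j < n.+1) (M^-1 * a j) *: e j =
    M^-1 *: \sum_(i < n.+1) a i *: e i.
  by rewrite scaler_sumr; apply: eq_bigr => j _; rewrite scalerA.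
by rewrite !pZ ler_pM2l// normr_gt0 invr_eq0 gt_eqF.
Qed.

(** The lower bound [c] of the seminormalized subsequence passes to the limit. [plegma_suppression]
    only supplies a plegma tuple far enough out. *)
Lemma spreading_model_gt0 i : 0 < p (e i).
Proof.
have [c [C [c0 _ cx]]] := x_seminormalized.
apply: (lt_le_trans c0); apply/ler_addgt0Pr => d d0.
have [M0 M0P] := spreading_approx i d0.
pose a (j : 'I_i.+1) : R := (j == ord_max)%:R.
have a1 j : `|a j| <= 1 by rewrite /a; case: eqP; rewrite ?normr1 ?normr0.
have [s [ps rs Ms _]] :=
  plegma_suppression F_rt L_infinite x_sub x_null ord_max M0 d0 a1.
have sumE (V : lmodType R) (v : 'I_i.+1 -> V) :
    \sum_j a j *: v j = v ord_max.
  rewrite (bigD1 ord_max)//= big1 ?addr0 ?/a ?eqxx ?scale1r// => j /negbTE ->.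
  by rewrite scale0r.
have := M0P s a ps rs Ms a1.
rewrite (sumE X (fun j => x (s j))) (sumE E (fun j => e j)) ler_distl => /andP[_].
by apply: le_trans; have /andP[] := cx _ (rs ord_max).
Qed.

End SpreadingModel.

Theorem theorem0p11 (R : realType) (X : completeNormedModType R)
    (F : fin_family) (L : set nat) (x : {fset nat} -> X)
    (E : lmodType R) (p : E -> R) (e : nat -> E)
    (F_positive : family_on_positives F) (F_regular_thin : regular_thin F)
    (L_positive : (L `<=` positives)%classic) (L_infinite : infinite_set L)
    (x_seminormalized : seminormalized F L x)
    (x_subordinated : subordinated F L x)
    (x_weakly_null : weakly_null F L x)
    (p_seminorm : seminorm p) (e_basis : hamel_basis e)
    (x_generates : generates F L x p e) :
  unconditional p e.
Proof.
have suppress := spreading_model_suppress F_regular_thin L_infinite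
  x_subordinated x_weakly_null p_seminorm x_generates.
split; last by exists 1 => // n A a; rewrite mul1r.
move=> n a pa0; apply: big1 => i _; suff -> : a i = 0 by rewrite scale0r.
(* Keeping only coordinate [i] of a combination of seminorm 0 gives [|a i| * p (e i) <= 0], where
   [p (e i)] is positive. *)
have := suppress n [set i]%SET a; rewrite big_set1 pa0.
have [p0 _ pZ] := p_seminorm; rewrite pZ => le0.
have pe := spreading_model_gt0 F_regular_thin L_infinite x_seminormalized
  x_subordinated x_weakly_null x_generates i.
by apply/eqP; rewrite -normr_le0 -(pmulr_lle0 _ pe).
Qed.
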